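(* Let $n$ be a positive even integer and $m=2^{n/2}+1$. A partition $P=\{P_1,\dots,P_m\}$ of $\mathbb{F}_2^n\setminus\{\overline 0\}$ is an $n/2$-spread if and only if it defines a perfect coloring of the subspace hypergraph $\mathcal{H}_n$ (a vertex $x$ having color $i$ iff $x\in P_i$) with the parameter matrix $S$ whose entries are: - $s_{i,j,k}=1/2$ for all distinct $i,j,k\in\{1,\dots,m\}$; - $s_{i,i,j}=s_{i,j,i}=s_{j,i,i}=0$ for all distinct $i,j\in\{1,\dots,m\}$; - $s_{i,i,i}=2^{n/2-1}-1$ for all $i\in\{1,\dots,m\}$.
   Context: $\overline 0$ is the zero vector. An $n/2$-spread of $\mathbb{F}_2^n$ ($n$ even) is a partition $\{P_1,\dots,P_m\}$, $m=\frac{2^n-1}{2^{n/2}-1}=2^{n/2}+1$, of $\mathbb{F}_2^n\setminus\{\overline 0\}$ such that each $P_j\cup\{\overline 0\}$ is an $n/2$-dimensional linear subspace. The subspace hypergraph $\mathcal{H}_n$ is the $3$-uniform hypergraph with vertex set $\mathbb{F}_2^n\setminus\{\overline 0\}$ whose hyperedges are the $3$-element sets $\{x,y,z\}$ of vertices with $x+y+z=\overline 0$. A coloring of a hypergraph is a surjective function $f$ from the vertex set onto the set of colors. The color range of a hyperedge $e$ is the multiset $\{f(x):x\in e\}$. The coloring is perfect if any two vertices of the same color have the same multiset of color ranges of incident hyperedges; equivalently, for every color $i_1$ and color range $\{i_1,i_2,i_3\}$, the number $v_{i_1,\{i_1,i_2,i_3\}}$ of hyperedges with this color range incident to a vertex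 $x$ of color $i_1$ does not depend on the choice of $x$. The parameter matrix of a perfect coloring of a $3$-uniform hypergraph is $S=(s_{i_1,i_2,i_3})$ (indices ranging over colors) with $s_{i,j,j}=v_{i,\{i,j,j\}}$ and $s_{i,j,\ell}=\frac12 v_{i,\{i,j,\ell\}}$ for $j\ne\ell$. *)

(* Defs.v *)
(* MathComp world, with {mset _} from mathcomp-finmap for multisets. *)
From HB Require Import structures.
From mathcomp Require Export all_boot all_order all_algebra.
From mathcomp Require Export finmap multiset.

Set Implicit Arguments.
Unset Strict Implicit.
Unset Printing Implicit Defensive.

Import GRing.Theory.
Local Open Scope mset_scope.
Local Open Scope ring_scope.

Record hypergraph := Hypergraph {
  vertex : finType;
  hyperedges : {set {set vertex}}
}.

Section Colorings.

Variables (H : hypergraph) (C : choiceType) (f : vertex H -> C).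

Definition is_coloring : Prop := forall c, exists x, f x = c.

Definition color_range (e : {set vertex H}) : {mset C} :=
  seq_mset [seq f x | x in e].

Definition incident_color_ranges (x : vertex H) : {mset {mset C}} :=
  seq_mset [seq color_range e | e in [set e in hyperedges H | x \in e]].

Definition perfect_coloring : Prop :=
  is_coloring /\
  forall x y, f x = f y -> incident_color_ranges x = incident_color_ranges y.

Definition num_incident (x : vertex H) (r : {mset C}) : nat :=
  #|[set e in hyperedges H | (x \in e) && (color_range e == r)]|.

(* For a perfect coloring, num_incident x r depends on x only through f x, and
   every color is the color of some vertex, so that at most one S satisfies
   this predicate. It is meant for 3-uniform hypergraphs. *)
Definition has_parameter_matrix (S : C -> C -> C -> rat) : Prop :=
  forall (x : vertex H) (j l : C),
    S (f x) j l = if j == l then (num_incident x [mset f x; j; j])%:R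
                  else (num_incident x [mset f x; j; l])%:R / 2.

End Colorings.

Definition subspace_hypergraph (n : nat) : hypergraph :=
  @Hypergraph {x : 'rV['F_2]_n | x != 0}
    [set e : {set {x : 'rV['F_2]_n | x != 0}} |
      (#|e| == 3)%N && (\sum_(x in e) val x == 0)].

Definition indexed_partition (T I : finType) (P : I -> {set T}) (D : {set T}) :
  Prop := injective P /\ partition [set P i | i : I] D.

Definition is_half_spread (n : nat) (I : finType)
    (P : I -> {set 'rV['F_2]_n}) : Prop :=
  indexed_partition P [set x | x != 0] /\
  forall i, exists2 U : {vspace 'rV['F_2]_n},
    \dim U = n./2 & 0 |: P i = [set x | x \in U].

(* Colors are numbered from 0 to m - 1. Two indices are equal and the third
   one differs in the case left to the last branch. *)
Definition spread_matrix (n m : nat) (i j k : 'I_m) : rat :=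
  if uniq [:: i; j; k] then 1 / 2
  else if (i == j) && (j == k) then 2 ^+ (n./2 - 1) - 1
  else 0.

(* Main.v *)
Require Import Defs.
From mathcomp Require Import finfield.
From mathcomp Require Import zify.

Set Implicit Arguments.
Unset Strict Implicit.
Unset Printing Implicit Defensive.

Import GRing.Theory.
Local Open Scope ring_scope.

(** Over F_2 two distinct nonzero vectors x and y lie on exactly one hyperedge,
    {x, y, x + y}. Hence the hyperedges through x with a given color range r
    can be counted, each of them twice, by the vectors y != x such that the
    colors of x, y and x + y form r ([double_num_incident]). This turns the
    entries of the parameter matrix into cardinals of sets of vectors.

    Suppose that the color classes are the nonzero parts of half-dimensional
    subspaces U_i. A hyperedge with two vertices of one color is then
    monochromatic, because U_i is closed under addition, so mixed ranges with a
    repeated color do not occur, and the monochromatic hyperedges through x are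
    counted by the 2 ^ (n/2) - 2 vectors of U_i other than 0 and x. If i, j, l
    are distinct and x has color i, then F_2^n is the direct sum of U_j and
    U_l, so that x has a unique decomposition as a sum of a vector of color j
    and a vector of color l: a single hyperedge ([num_incident_spread]).
    Perfection is automatic once the incidence numbers are given by a matrix
    ([perfect_coloring_of_matrix]): all color ranges at x contain the color of
    x, hence are all covered by the matrix.

    Conversely, the vanishing of s_{i,i,j} says exactly that two vectors of
    color i never have a sum of another color, so that each class together with
    0 is closed under addition, and over F_2 this makes it a subspace
    ([color_class_vspace]). The entry s_{i,i,i} gives the cardinal of the class,
    hence the dimension ([dim_color_class]). *)

(** * Multisets of colors *)

Lemma mset3E (K : choiceType) (a b c : K) :
  [mset a; b; c]%mset = seq_mset [:: a; b; c].
Proof.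
apply/msetP => k.
by rewrite !msetE2 !msetnE mset_seqE /= ![k == _]eq_sym; do !case: eqP.
Qed.

Lemma eq_mset3_head (K : choiceType) (a b c j l : K) :
  ([mset a; b; c]%mset == [mset a; j; l]%mset) =
  (b == j) && (c == l) || (b == l) && (c == j).
Proof.
rewrite !mset3E -(sameP (eq_seq_msetP _ _) eqP) perm_cons.
have [->|bj] /= := eqVneq b j.
  rewrite perm_cons; apply/idP/idP => [/perm_mem/(_ l)|].
    by rewrite !inE eqxx eq_sym => ->.
  by case/orP => [/eqP->|/andP[/eqP-> /eqP->]].
apply/idP/andP => [/perm_mem e|[/eqP-> /eqP->]]; last first.
  by rewrite (perm_catC [:: l] [:: j]).
have bl : b == l by have := e b; rewrite !inE eqxx (negPf bj).
split=> //; have := e j; rewrite !inE eqxx.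
by rewrite [j == b]eq_sym (negPf bj) eq_sym.
Qed.

(** * Colorings of hypergraphs *)

Lemma count_incident_color_ranges (H : hypergraph) (C : choiceType)
    (f : vertex H -> C) (x : vertex H) (r : {mset C}%mset) :
  incident_color_ranges f x r = num_incident f x r.
Proof.
rewrite mset_seqE count_map -size_filter /num_incident cardE.
apply/perm_size/uniq_perm => [||e].
- by apply: filter_uniq; apply: enum_uniq.
- exact: enum_uniq.
by rewrite mem_filter !mem_enum !inE andbC andbA.
Qed.

(** * Hyperedges of the subspace hypergraph *)

Lemma addvv n (u : 'rV['F_2]_n) : u + u = 0.
Proof. by apply/rowP => i; rewrite !mxE (addrr_pchar2 (pchar_Fp _)). Qed.

Lemma addv_eq0 n (u v : 'rV['F_2]_n) : u + v = 0 -> v = u.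
Proof. by move=> e; rewrite -[RHS]addr0 -(addvv v) addrA e add0r. Qed.

Notation nonzero n := (vertex (subspace_hypergraph n)).

(** The third vertex of the hyperedge through two distinct vertices; the default
    value x is taken only when x = y. *)
Definition third n (x y : nonzero n) : nonzero n := insubd x (val x + val y).

Section Lines.

Variable n : nat.
Implicit Types (x y z : nonzero n).

Lemma val_third x y : x != y -> val (third x y) = val x + val y.
Proof.
move=> xy; rewrite insubdK //; apply: contraNN xy => /eqP e.
by apply/eqP/val_inj; rewrite (addv_eq0 e).
Qed.

Lemma thirdC x y : x != y -> third y x = third x y.
Proof. by move=> xy; apply: val_inj; rewrite !val_third 1?addrC // eq_sym. Qed.

Lemma third_neql x y : x != y -> third x y != x.
Proof.
move=> xy; apply/eqP => /(congr1 val); rewrite val_third // => /eqP.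
by rewrite -subr_eq0 addrC addKr; apply/negP; exact: (valP y).
Qed.

Lemma third_neqr x y : x != y -> third x y != y.
Proof. by move=> xy; rewrite -thirdC // third_neql // eq_sym. Qed.

Lemma thirdK x y : x != y -> third x (third x y) = y.
Proof.
move=> xy; apply: val_inj.
by rewrite val_third 1?eq_sym ?third_neql // val_third // addrA addvv add0r.
Qed.

Lemma third_uniq x y : x != y -> uniq [:: x; y; third x y].
Proof.
move=> xy; rewrite /= !inE negb_or xy ![_ == third x y]eq_sym.
by rewrite third_neql // third_neqr.
Qed.

Lemma edge_third x y : x != y ->
  [set x; y; third x y] \in hyperedges (subspace_hypergraph n).
Proof.
move=> xy; have := third_uniq xy.
rewrite /= !inE negb_or -andbA => /and4P[_ xz yz _].
have xU : x \notin [set y; third x y] by rewrite !inE negb_or xy.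
have yU : y \notin [set third x y] by rewrite inE.
rewrite -setUA; apply/andP; split; first by rewrite cardsU1 cards2 xU yz.
rewrite (big_setU1 _ xU) (big_setU1 _ yU) big_set1 val_third //=.
by rewrite addrA addvv.
Qed.

(** Two vertices of a hyperedge determine it: the sum of its three vertices is
    zero, so the remaining one is the sum of the other two. *)
Lemma edge_eq x y e : e \in hyperedges (subspace_hypergraph n) ->
  x \in e -> y \in e -> x != y -> e = [set x; y; third x y].
Proof.
rewrite inE => /andP[/eqP c3 /eqP s0] xe ye xy.
have yex : y \in e :\ x by rewrite !inE eq_sym xy.
have : #|e :\ x :\ y| == 1%N.
  have := cardsD1 x e; rewrite c3 (cardsD1 y (e :\ x)) xe yex !add1n.
  by move=> -[<-].
case/cards1P => z ez.
have -> : e = [set x; y; z] by rewrite -setUA -ez !setD1K.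
congr (_ :|: [set _]); apply: val_inj; rewrite val_third //.
move: s0; rewrite (big_setD1 x) //= (big_setD1 y) //= ez big_set1.
by rewrite addrA => /addv_eq0.
Qed.

End Lines.

(** * Counting hyperedges by color range *)

Lemma color_range3 n (C : choiceType) (f : nonzero n -> C) (x y : nonzero n) :
  x != y ->
  color_range f [set x; y; third x y] =
  [mset f x; f y; f (third x y)]%mset.
Proof.
move=> xy; rewrite mset3E; apply/eq_seq_msetP.
apply: (perm_map f (s := enum _) (t := [:: x; y; third x y])).
apply: uniq_perm; first exact: enum_uniq.
  exact: third_uniq.
by move=> z; rewrite mem_enum !inE orbA.
Qed.

(** The map sending y to the hyperedge {x, y, x + y} is two-to-one onto the
    hyperedges through x: its fiber over e is e minus x. *)
Lemma double_num_incident n (C : choiceType) (f : nonzero n -> C) x r :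
  (num_incident f x r).*2 =
  #|[set y : nonzero n |
      (x != y) && ([mset f x; f y; f (third x y)]%mset == r)]|.
Proof.
rewrite -muln2 -[RHS]sum1_card.
rewrite (partition_big (fun y : nonzero n => [set x; y; third x y]) (fun e =>
  e \in [set e in hyperedges (subspace_hypergraph n) |
           (x \in e) && (color_range f e == r)])) /=; last first.
  move=> y; rewrite inE => /andP[xy ?].
  by rewrite inE edge_third // color_range3 // !inE eqxx.
rewrite /num_incident -sum_nat_const; apply: eq_bigr => e.
rewrite inE => /andP[eE /andP[xe er]].
rewrite sum1dep_card.
transitivity #|e :\ x|.
  move: eE; rewrite inE => /andP[/eqP c3 _].
  by have := cardsD1 x e; rewrite c3 xe add1n => -[].
apply: eq_card => y; rewrite !inE; apply/andP/andP => [[yx ye]|].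
  have xy : x != y by rewrite eq_sym.
  have eE3 := edge_eq eE xe ye xy.
  by rewrite xy -color_range3 // -eE3 er eqxx.
case=> /andP[xy _] /eqP <-.
by split; [rewrite eq_sym | rewrite !inE eqxx orbT].
Qed.

Lemma double_num_incident_colors n (C : choiceType) (f : nonzero n -> C)
    x j l :
  (num_incident f x [mset f x; j; l]%mset).*2 =
  #|[set y : nonzero n | (x != y) &&
      ((f y == j) && (f (third x y) == l) ||
       (f y == l) && (f (third x y) == j))]|.
Proof.
rewrite double_num_incident; apply: eq_card => y.
by rewrite !inE eq_mset3_head.
Qed.

(** If lines through two points of color f x stay in that color, every other
    vector of the color class contributes to the count for the monochromatic
    range. *)
Lemma card_color_class_num_incident n (C : choiceType) (f : nonzero n -> C) x :
  (forall y, x != y -> f y = f x -> f (third x y) = f x) ->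
  #|[set y : nonzero n | f y == f x]| =
  (num_incident f x [mset f x; f x; f x]%mset).*2.+1.
Proof.
move=> closed; rewrite double_num_incident_colors (cardsD1 x) inE eqxx add1n.
congr _.+1; apply: eq_card => y; rewrite !inE orbb.
apply/andP/andP => -[xy]; last by case/andP=> fy _; rewrite eq_sym.
move/eqP => yx; have xy' : x != y by rewrite eq_sym.
by rewrite xy' yx closed // eqxx.
Qed.

Lemma num_incident_neq0 n (C : choiceType) (f : nonzero n -> C) x r :
  num_incident f x r != 0%N -> exists j l, r = [mset f x; j; l]%mset.
Proof.
rewrite -double_eq0 double_num_incident cards_eq0 => /set0Pn[y].
by rewrite inE => /andP[_ /eqP <-]; exists (f y), (f (third x y)).
Qed.

(** The matrix only speaks of ranges of the form {f x, j, l}; these are the only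
    ranges that hyperedges through x can have, and for all others both
    incidence numbers are zero. *)
Lemma perfect_coloring_of_matrix n (C : choiceType) (f : nonzero n -> C) S :
  is_coloring f -> has_parameter_matrix f S -> perfect_coloring f.
Proof.
move=> f_surj fS; split=> // x y fxy; apply/msetP => r.
rewrite !count_incident_color_ranges.
have n2 : (2 : rat) != 0 by [].
have num_eq x' y' : f x' = f y' -> num_incident f x' r != 0%N ->
    num_incident f x' r = num_incident f y' r.
  move=> fxy' /num_incident_neq0[j [l ->]].
  have := fS x' j l; rewrite fxy' fS.
  by case: eqP => [->|_ /(divIf n2)] /eqP; rewrite Num.Theory.eqr_nat => /eqP->.
have [nx|] := eqVneq (num_incident f x r) 0%N; last exact: num_eq.
have [ny|ny] := eqVneq (num_incident f y r) 0%N; first by rewrite nx ny.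
by rewrite (num_eq y x).
Qed.

(** Twice the number of hyperedges with range {i, j, k} through a vertex of
    color i in a spread coloring with classes of dimension h; doubling avoids
    both the halves and the rational numbers of the parameter matrix. *)
Definition spread_count (m : nat) (h : nat) (i j k : 'I_m) : nat :=
  (if uniq [:: i; j; k] then 2
   else if (i == j) && (j == k) then 2 ^ h - 2 else 0)%N.

Lemma has_spread_matrixP n m (f : nonzero n -> 'I_m) : (0 < n./2)%N ->
  has_parameter_matrix f (@spread_matrix n m) <->
  forall x j l, (num_incident f x [mset f x; j; l]%mset).*2 =
                spread_count n./2 (f x) j l.
Proof.
move=> h0; suff step x j l :
    spread_matrix n (f x) j l =
      (if j == l then (num_incident f x [mset f x; j; j]%mset)%:R
       else (num_incident f x [mset f x; j; l]%mset)%:R / 2) <->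
    (num_incident f x [mset f x; j; l]%mset).*2 = spread_count n./2 (f x) j l.
  by split=> H x j l; apply/step/H.
rewrite /spread_matrix /spread_count /= !inE andbT.
have [->|jl] := eqVneq j l; rewrite ?orbb ?andbF ?andbT /=.
  set N := num_incident _ _ _; case: (f x == l); last first.
    split=> [/eqP|/eqP]; last by rewrite double_eq0 => /eqP->.
    by rewrite eq_sym (Num.Theory.eqr_nat rat N 0) => /eqP->.
  case: n./2 h0 => // h _; rewrite subSS subn0 -natrX expnS.
  have h1 : (0 < 2 ^ h)%N by rewrite expn_gt0.
  rewrite -(natrB rat h1); split=> [/eqP|]; last by move=> e; congr _%:R; lia.
  by rewrite Num.Theory.eqr_nat => /eqP; lia.
set N := num_incident _ _ _; have n2 : (2 : rat) != 0 by [].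
have halfE k : (k%:R / 2 = N%:R / 2 :> rat) <-> N.*2 = k.*2.
  split=> [/(divIf n2)/eqP|/double_inj ->//].
  by rewrite Num.Theory.eqr_nat => /eqP->.
case: (~~ _); first exact: (halfE 1%N).
by rewrite -[in X in X <-> _](mul0r 2^-1); exact: (halfE 0%N).
Qed.

(** * The coloring defined by a spread *)

Section SpreadColoring.

Variables (n m : nat) (f : nonzero n -> 'I_m).
Variable U : 'I_m -> {vspace 'rV['F_2]_n}.
Hypothesis fU : forall x i, f x = i <-> val x \in U i.

Lemma color_third x y : x != y -> f x = f y -> f (third x y) = f x.
Proof.
move=> xy fxy; apply/fU; rewrite val_third //.
by apply: memvD; apply/fU.
Qed.

(** By the involution [third x], closure under addition is an equivalence; it
    excludes the ranges {f x, f x, c} with c different from f x, whichever of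
    the two other vertices of the hyperedge has color f x. *)
Lemma color_third_eq x y : x != y -> (f (third x y) == f x) = (f y == f x).
Proof.
move=> xy; have xz : x != third x y by rewrite eq_sym third_neql.
apply/eqP/eqP => e; last by rewrite color_third.
by rewrite -(color_third xz (esym e)) thirdK.
Qed.

Lemma color_spaces_meet i j v : i != j -> v \in U i -> v \in U j -> v = 0.
Proof.
move=> ij vi vj; apply/eqP; apply: contraNT ij => v0.
pose x : nonzero n := Sub v v0.
have /fU <- : val x \in U i by rewrite SubK.
by apply/eqP/fU; rewrite SubK.
Qed.

(** The successor accounts for the zero vector, which has no color. *)
Lemma card_color_class i :
  #|[set y : nonzero n | f y == i]|.+1 = (2 ^ \dim (U i))%N.
Proof.
rewrite -{1}[2%N](card_Fp (isT : prime 2)) -card_vspace (cardD1 0) mem0v add1n.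
congr _.+1; rewrite -(card_imset _ val_inj); apply: eq_card => v.
rewrite !inE; apply/imsetP/andP => [[y]|[v0 vU]].
  by rewrite inE => /eqP/fU yU ->; rewrite yU (valP y).
exists (Sub v v0); last by rewrite SubK.
by rewrite inE; apply/eqP/fU; rewrite SubK.
Qed.

Lemma num_incident_spread :
  (forall i, \dim (U i) = n./2) -> ~~ odd n -> forall x j l,
  (num_incident f x [mset f x; j; l]%mset).*2 = spread_count n./2 (f x) j l.
Proof.
move=> dimU nE x j l; rewrite /spread_count.
rewrite /= !inE andbT.
have [<-{j}|xj] := eqVneq (f x) j => /=.
  have [<-{l}|xl] := eqVneq (f x) l => /=.
    rewrite -(dimU (f x)) -card_color_class.
    rewrite card_color_class_num_incident ?subSS ?subn0 // => y xy fyx.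
    exact: color_third.
  rewrite double_num_incident_colors; apply: eq_card0 => y.
  rewrite !inE; apply/negP => /andP[/color_third_eq xy].
  by case/orP=> /andP[/eqP yc /eqP zc]; move: xy;
    rewrite yc zc eqxx eq_sym (negPf xl).
have [<-|jl] := eqVneq j l; first rewrite andbF /=.
  rewrite double_num_incident_colors; apply: eq_card0 => y.
  rewrite !inE orbb; apply/negP => /and3P[xy /eqP a /eqP b].
  (* x would be the sum of two vectors of U j. *)
  case/eqP: xj; apply/fU.
  have -> : val x = val (third x y) + val y.
    by rewrite val_third // -addrA addvv addr0.
  by apply: memvD; apply/fU.
have [<-|xl] /= := eqVneq (f x) l.
  rewrite double_num_incident_colors; apply: eq_card0 => y.
  rewrite !inE; apply/negP => /andP[/color_third_eq xy].
  by case/orP=> /andP[/eqP yc /eqP zc]; move: xy;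
    rewrite yc zc eqxx eq_sym (negPf xj).
(* The colors are distinct: the count is 2, one for each of the two summands
   in the decomposition of x along the direct sum of U j and U l. *)
have meet0 : (U j :&: U l)%VS = 0%VS.
  apply/eqP; rewrite -subv0; apply/subvP => v; rewrite memv_cap memv0.
  by case/andP=> vj vl; apply/eqP/(color_spaces_meet jl).
have Ujl : (U j + U l)%VS = fullv.
  apply/eqP; rewrite eqEdim subvf dimvf dim_matrix mul1r.
  by rewrite dimv_disjoint_sum // !dimU addnn even_halfK ?leqnn.
have /memv_addP[u uj [v vl xuv]] : val x \in (U j + U l)%VS.
  by rewrite Ujl memvf.
have u0 : u != 0.
  apply: contraNneq xl => u0; apply/eqP/fU.
  by rewrite xuv u0 add0r.
have v0 : v != 0.
  apply: contraNneq xj => v0; apply/eqP/fU.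
  by rewrite xuv v0 addr0.
pose y0 : nonzero n := Sub u u0.
have fy0 : f y0 = j by apply/fU; rewrite SubK.
have xy0 : x != y0 by apply: contraNneq xj => ->; rewrite fy0.
have third_y0 : val (third x y0) = v.
  by rewrite val_third // SubK xuv addrAC addvv add0r.
have fz0 : f (third x y0) = l by apply/fU; rewrite third_y0.
rewrite double_num_incident_colors.
transitivity #|[set y0; third x y0]|; last by rewrite cards2 eq_sym third_neqr.
apply: eq_card => y; rewrite !inE; apply/andP/orP; last first.
  case=> /eqP ->; first by rewrite xy0 fy0 fz0 !eqxx.
  by rewrite eq_sym third_neql // thirdK // fy0 fz0 !eqxx orbT.
have unique y1 : x != y1 -> f y1 = j -> f (third x y1) = l -> y1 = y0.
  move=> xy1 fy1 fz1; apply/val_inj/esym/addv_eq0.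
  apply: (color_spaces_meet jl); first by apply: memvD; apply/fU.
  have -> : val y1 + val y0 = val (third x y1) + val (third x y0).
    by rewrite !val_third // addrACA addvv add0r.
  by apply: memvD; apply/fU.
case=> xy /orP[] /andP[/eqP fy /eqP fz]; first by left; apply/eqP/unique.
have xz : x != third x y by rewrite eq_sym third_neql.
have zy0 : third x y = y0 by apply: unique => //; rewrite (thirdK xy).
by right; rewrite -zy0 (thirdK xy).
Qed.

End SpreadColoring.

(** * The spread defined by a coloring *)

(** The scalars of F_2 are 0 and 1, so closure under scaling comes for free. *)
Lemma vspace_of_addr_closed n (A : {set 'rV['F_2]_n}) :
  0 \in A -> {in A &, forall u v, u + v \in A} ->
  exists U : {vspace 'rV['F_2]_n}, A = [set v | v \in U].
Proof.
move=> A0 AD; exists <<enum A>>%VS; apply/setP => v; rewrite inE.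
apply/idP/idP => [vA|/(@coord_span _ _ _ (in_tuple _)) ->].
  by apply: memv_span; rewrite mem_enum.
apply: (big_ind (fun w => w \in A)) => // i _.
have Ai : (in_tuple (enum A))`_i \in A by rewrite -mem_enum mem_nth.
case: (coord _ i v) => -[|[|//]] lt2 /=.
  by rewrite (_ : Ordinal _ = 0) ?scale0r //; apply: val_inj.
by rewrite (_ : Ordinal _ = 1) ?scale1r //; apply: val_inj.
Qed.

Section SpreadMatrix.

Variables (n m : nat) (f : nonzero n -> 'I_m).
Hypothesis num_f : forall x j l,
  (num_incident f x [mset f x; j; l]%mset).*2 = spread_count n./2 (f x) j l.

(** If x + y had another color l, the hyperedge {x, y, x + y} would have the
    range {i, i, l}, whose count is zero. *)
Lemma color_third_of_count x y : x != y -> f x = f y -> f (third x y) = f x.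
Proof.
move=> xy fxy; apply/eqP; rewrite eq_sym; apply/negPn/negP => xz.
have := num_f x (f x) (f (third x y)).
rewrite /spread_count /= !inE eqxx (negPf xz) /= double_num_incident_colors.
move/eqP; rewrite cards_eq0 => /eqP/setP/(_ y).
by rewrite !inE xy fxy !eqxx.
Qed.

Lemma color_class_vspace i : exists U : {vspace 'rV['F_2]_n},
  forall x, f x = i <-> val x \in U.
Proof.
pose A : {set 'rV['F_2]_n} :=
  0 |: [set val x | x : nonzero n & f x == i].
have [||U AU] := @vspace_of_addr_closed n A; first by rewrite !inE eqxx.
  move=> u v; rewrite !in_setU1.
  case/predU1P=> [->|uA]; first by rewrite add0r.
  case/predU1P=> [->|vA]; first by rewrite addr0 uA orbT.
  case/imsetP: uA vA => x; rewrite inE => /eqP fx -> /imsetP[y].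
  rewrite inE => /eqP fy ->; have [<-|xy] := eqVneq x y.
    by rewrite addvv eqxx.
  rewrite -val_third //; apply/orP; right.
  by apply: imset_f; rewrite inE color_third_of_count ?fx ?fy.
exists U => x; have -> : (val x \in U) = (val x \in A) by rewrite AU inE.
rewrite in_setU1 (negPf (valP x)) mem_imset ?inE; last exact: val_inj.
by split=> /eqP.
Qed.

Lemma dim_color_class (U : 'I_m -> {vspace 'rV['F_2]_n}) x :
  (0 < n./2)%N -> (forall x i, f x = i <-> val x \in U i) ->
  \dim (U (f x)) = n./2.
Proof.
move=> h0 fU; apply: (@expnI 2) => //; rewrite -(card_color_class fU).
rewrite card_color_class_num_incident; last first.
  by move=> y xy fy; apply: color_third_of_count.
have h2 : (2 <= 2 ^ n./2)%N by rewrite -{1}(expn1 2) leq_exp2l.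
by rewrite num_f /spread_count /= !inE eqxx /=; lia.
Qed.

End SpreadMatrix.

(** * Indexed partitions *)

Section IndexedPartition.

Variables (T I : finType) (P : I -> {set T}) (D : {set T}).
Hypothesis hP : indexed_partition P D.

Lemma indexed_partition_ex x : x \in D -> exists i, x \in P i.
Proof.
case: hP => _ /cover_partition <- /bigcupP[_ /imsetP[i _ ->]]; by exists i.
Qed.

Lemma indexed_partition_sub i x : x \in P i -> x \in D.
Proof.
case: hP => _ /cover_partition <- xi; apply/bigcupP.
by exists (P i) => //; apply: imset_f.
Qed.

Lemma indexed_partition_neq0 i : exists x, x \in P i.
Proof.
case: hP => _ /and3P[_ _ P0]; apply/set0Pn; apply: contraNneq P0 => <-.
exact: imset_f.
Qed.

Lemma indexed_partition_inj i j x : x \in P i -> x \in P j -> i = j.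
Proof.
case: hP => Pinj /and3P[_ tP _] xi xj; apply: Pinj.
by rewrite -(def_pblock tP _ xi) ?imset_f // (def_pblock tP _ xj) ?imset_f.
Qed.

End IndexedPartition.

(** * Spreads and perfect colorings *)

Theorem theorem8 (n m : nat) (hn0 : (0 < n)%N) (hn : ~~ odd n)
    (hm : m = (2 ^ n./2 + 1)%N)
    (P : 'I_m -> {set 'rV['F_2]_n})
    (hP : indexed_partition P [set x | x != 0]) :
  is_half_spread P <->
  exists f : vertex (subspace_hypergraph n) -> 'I_m,
    [/\ forall x i, f x = i <-> val x \in P i,
        perfect_coloring f
      & has_parameter_matrix f (@spread_matrix n m)].
Proof.
have h0 : (0 < n./2)%N by rewrite half_gt0; case: (n) hn0 hn => [|[|]].
have surj_f (f : nonzero n -> 'I_m) :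
    (forall x i, f x = i <-> val x \in P i) -> is_coloring f.
  move=> fP i; have [v vi] := indexed_partition_neq0 hP i.
  have v0 : v != 0 by have := indexed_partition_sub hP vi; rewrite inE.
  by exists (Sub v v0); apply/fP; rewrite SubK.
split=> [[_ PU]|[f [fP f_perf /(has_spread_matrixP _ h0) num_f]]].
  have [U dimU] := fin_all_exists2 PU => PUE.
  have exP (x : nonzero n) : exists i, val x \in P i.
    by apply: (indexed_partition_ex hP); rewrite inE; exact: (valP x).
  have [f xf] := fin_all_exists exP.
  have fP x i : f x = i <-> val x \in P i.
    by split=> [<- //|]; exact: (indexed_partition_inj hP (xf x)).
  have fU x i : f x = i <-> val x \in U i.
    have := congr1 (fun A : {set _} => val x \in A) (PUE i).
    by rewrite in_setU1 (negPf (valP x)) inE => <-.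
  have f_mx : has_parameter_matrix f (@spread_matrix n m).
    by apply/has_spread_matrixP => //; apply: (num_incident_spread fU dimU).
  exists f; split=> //.
  exact: perfect_coloring_of_matrix (surj_f f fP) f_mx.
split=> // i; have [U fU] := fin_all_exists (color_class_vspace num_f).
have [x fx] := surj_f f fP i; exists (U i).
  by rewrite -fx; apply: (dim_color_class num_f).
apply/setP => v; rewrite in_setU1 inE; have [->|v0] := eqVneq v 0.
  by rewrite mem0v.
have [y ->] : exists y : nonzero n, v = val y.
  by exists (Sub v v0); rewrite SubK.
by apply/idP/idP => [/fP/fU|/fU/fP].
Qed.
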